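(* Let $ABC$ be a nondegenerate triangle with circumcenter $O$ and circumcircle $\omega_{ABC}$. For every admissible pair of cevians $BB_A, CC_A$ with intersection point $N_A$ and Miquel–Steiner point $M_A$, one has $M_A=O$ if and only if $|BB_A|=|CB_A|$ and $|CC_A|=|BC_A|$. Moreover, in this case $N_A\in\omega_{ABC}$.
   Context: Work in the Euclidean plane with a nondegenerate triangle $ABC$. An admissible pair of cevians consists of lines $BB_A$ and $CC_A$, where $B_A$ is a point of line $AC$ with $B_A\neq A, C$, and $C_A$ is a point of line $AB$ with $C_A\neq A, B$ (the points may lie outside the sides), such that $BB_A$ and $CC_A$ are not parallel. Let $N_A$ be the intersection point of $BB_A$ and $CC_A$. The circumcircles of the four triangles $ABB_A$, $ACC_A$, $CB_AN_A$, $BC_AN_A$ have a unique common point $M_A$, called the Miquel–Steiner point of triangle $ABC$ with cevians $BB_A, CC_A$ (equivalently, $M_A$ is the common point other than $A$ of the circumcircles of $ABB_A$ and $ACC_A$). *)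

(* Defs.v *)
From Stdlib Require Import Reals.
Open Scope R_scope.

Definition point : Type := (R * R)%type.

Definition edist (P Q : point) : R := dist_euc (fst P) (snd P) (fst Q) (snd Q).

(* Cross product of the vectors PQ and ST. *)
Definition cross (P Q S T : point) : R :=
  (fst Q - fst P) * (snd T - snd S) - (snd Q - snd P) * (fst T - fst S).

(* For P <> Q, [collinear P Q X] says that X lies on the line PQ; if P = Q it
   holds for every X. *)
Definition collinear (P Q X : point) : Prop := cross P Q P X = 0.

Definition parallel (P Q S T : point) : Prop := cross P Q S T = 0.

Definition nondegenerate (A B C : point) : Prop := ~ collinear A B C.

Definition is_circumcenter (A B C O : point) : Prop :=
  edist O A = edist O B /\ edist O A = edist O C.

(* The circumcircle is the usual one only for nondegenerate A B C. *)
Definition on_circumcircle (A B C X : point) : Prop :=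
  exists O : point, is_circumcenter A B C O /\ edist O X = edist O A.

Definition admissible_cevians (A B C BA CA : point) : Prop :=
  (collinear A C BA /\ BA <> A /\ BA <> C) /\
  (collinear A B CA /\ CA <> A /\ CA <> B) /\
  ~ parallel B BA C CA.

Definition is_cevian_intersection (B C BA CA N : point) : Prop :=
  collinear B BA N /\ collinear C CA N.

(* For a nondegenerate triangle with admissible cevians meeting at N, the four
   triangles are nondegenerate and exactly one point M has this property, so
   uniqueness is not part of the definition. *)
Definition is_miquel_steiner (A B C BA CA N M : point) : Prop :=
  on_circumcircle A B BA M /\
  on_circumcircle A C CA M /\
  on_circumcircle C BA N M /\
  on_circumcircle B CA N M.

(* Main.v *)
Require Import Defs.
From Stdlib Require Import Reals Lra Psatz.
Open Scope R_scope.

(** With [A] as origin, a circle through [A] centred at [O'] is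
    [|X|^2 = 2 <O', X>]. In the basis [u = AB], [v = AC] the condition that the
    circumcenter of [ABC] lies on the circle [A B P], where [P] is on the line
    [AC], becomes linear in the position of [P], and is equivalent to
    [|BP| = |CP|]. Two distinct circles through [A] share at most one further
    point, so [M = O] exactly when [O] lies on both circles [A B BA] and
    [A C CA]. *)

Definition dot (P Q S : point) : R :=
  (fst Q - fst P) * (fst S - fst P) + (snd Q - snd P) * (snd S - snd P).

Lemma edist_eq_iff (P Q S T : point) :
  edist P Q = edist S T <-> dot P Q Q = dot S T T.
Proof.
  unfold edist, dist_euc, dot, Rsqr.
  split; intro H.
  - apply sqrt_inj in H; [lra| |]; apply Rplus_le_le_0_compat; apply Rle_0_sqr.
  - f_equal; lra.
Qed.

Lemma equidistant_iff_dot (O A X : point) :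
  edist O X = edist O A <-> dot A X X = 2 * dot A O X.
Proof.
  rewrite edist_eq_iff; unfold dot; split; intro H; lra.
Qed.

Lemma point_ext (P Q : point) : fst P = fst Q -> snd P = snd Q -> P = Q.
Proof. destruct P, Q; simpl; congruence. Qed.

Lemma dot_pos (P Q : point) : Q <> P -> 0 < dot P Q Q.
Proof.
  intro H.
  destruct (Req_dec (fst Q) (fst P)) as [E|E].
  - destruct (Req_dec (snd Q) (snd P)) as [E'|E'].
    + now elim H; apply point_ext.
    + apply Rplus_le_lt_0_compat; [apply Rle_0_sqr | apply Rlt_0_sqr; lra].
  - apply Rplus_lt_le_0_compat; [apply Rlt_0_sqr; lra | apply Rle_0_sqr].
Qed.

Lemma collinear_param (A C X : point) :
  C <> A -> collinear A C X ->
  exists t, fst X = fst A + t * (fst C - fst A) /\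
            snd X = snd A + t * (snd C - snd A).
Proof.
  intros HC HX.
  pose proof (dot_pos A C HC) as Hp.
  (* The coefficient of the orthogonal projection onto [AC]; both coordinate equations then hold up
     to a multiple of [cross A C A X], which vanishes. *)
  exists (dot A C X / dot A C C).
  unfold collinear in HX.
  split; apply Rmult_eq_reg_l with (2 := Rgt_not_eq _ _ Hp).
  - transitivity (dot A C C * fst A + dot A C X * (fst C - fst A)
                  - (snd C - snd A) * cross A C A X);
      [unfold dot, cross; ring | rewrite HX; field; lra].
  - transitivity (dot A C C * snd A + dot A C X * (snd C - snd A)
                  + (fst C - fst A) * cross A C A X);
      [unfold dot, cross; ring | rewrite HX; field; lra].
Qed.

(** A line meets a circle at most twice: at the point of parameter [t] on [AC], the equation of a
    circle through [A] and [C] becomes [t * (t - 1) * |AC|^2 = 0]. *)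
Lemma collinear_not_equidistant (A C P O : point) :
  C <> A -> collinear A C P -> P <> A -> P <> C ->
  edist O C = edist O A -> edist O P = edist O A -> False.
Proof.
  intros HC HP PA PC EC EP.
  apply equidistant_iff_dot in EC, EP.
  pose proof (dot_pos A C HC) as Hp.
  destruct (collinear_param A C P HC HP) as [t [Px Py]].
  assert (E : t * ((t - 1) * dot A C C) = 0).
  { replace (dot A P P) with (t * t * dot A C C) in EP
      by (unfold dot; rewrite Px, Py; ring).
    replace (dot A O P) with (t * dot A O C) in EP
      by (unfold dot; rewrite Px, Py; ring).
    apply (Rmult_eq_compat_l t) in EC; lra. }
  apply Rmult_integral in E as [E|E].
  - apply PA, point_ext; rewrite ?Px, ?Py, E; ring.
  - apply Rmult_integral in E as [E|E]; [|lra].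
    apply PC, point_ext; rewrite ?Px, ?Py; replace t with 1 by lra; ring.
Qed.

(** Subtracting the two circle equations puts [X] and [Y] on the radical axis, the line through [A]
    perpendicular to [O1 O2]; a line through [A] meets the first circle only once more. *)
Lemma second_intersection_unique (A O1 O2 X Y : point) :
  O1 <> O2 -> X <> A -> Y <> A ->
  edist O1 X = edist O1 A -> edist O2 X = edist O2 A ->
  edist O1 Y = edist O1 A -> edist O2 Y = edist O2 A -> X = Y.
Proof.
  intros HO HX HY X1 X2 Y1 Y2.
  apply equidistant_iff_dot in X1, X2, Y1, Y2.
  pose proof (dot_pos O2 O1 HO) as HOp.
  pose proof (dot_pos A X HX) as HXp.
  pose proof (dot_pos A Y HY) as HYp.
  assert (EX : (fst O1 - fst O2) * (fst X - fst A)
               + (snd O1 - snd O2) * (snd X - snd A) = 0)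
    by (unfold dot in X1, X2; lra).
  assert (EY : (fst O1 - fst O2) * (fst Y - fst A)
               + (snd O1 - snd O2) * (snd Y - snd A) = 0)
    by (unfold dot in Y1, Y2; lra).
  assert (HXY : collinear A X Y).
  { unfold collinear, cross.
    apply Rmult_eq_reg_l with (2 := Rgt_not_eq _ _ HOp).
    unfold dot. rewrite Rmult_0_r.
    (* With [w] the vector from [O2] to [O1] and [x], [y] those from [A] to [X], [Y], this is [|w|^2
       (x × y) = (w·x)(w × y) - (w·y)(w × x)]. *)
    transitivity
      (((fst O1 - fst O2) * (fst X - fst A)
         + (snd O1 - snd O2) * (snd X - snd A))
         * ((fst O1 - fst O2) * (snd Y - snd A)
            - (snd O1 - snd O2) * (fst Y - fst A))
       - ((fst O1 - fst O2) * (fst Y - fst A)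
         + (snd O1 - snd O2) * (snd Y - snd A))
         * ((fst O1 - fst O2) * (snd X - snd A)
            - (snd O1 - snd O2) * (fst X - fst A))); [ring|].
    rewrite EX, EY; ring. }
  destruct (Req_dec (dot X Y Y) 0) as [E|E].
  - destruct (Req_dec (fst Y) (fst X)), (Req_dec (snd Y) (snd X));
      unfold dot in E; try nra; now apply point_ext.
  - exfalso.
    apply (collinear_not_equidistant A X Y O1); auto.
    + intros ->; apply E; unfold dot; ring.
    + now apply equidistant_iff_dot.
    + now apply equidistant_iff_dot.
Qed.

Lemma nondegenerate_swap (A B C : point) :
  nondegenerate A B C -> nondegenerate A C B.
Proof. unfold nondegenerate, collinear, cross; intros H E; apply H; lra. Qed.

Lemma nondegenerate_neq (A B C : point) :
  nondegenerate A B C -> B <> A /\ C <> A.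
Proof.
  unfold nondegenerate, collinear, cross; intro H.
  split; intros ->; apply H; ring.
Qed.

(** By Lagrange's identity the Gram determinant of [AB] and [AC] is the square of their cross
    product. *)
Lemma gram_pos (A B C : point) :
  nondegenerate A B C -> 0 < dot A B B * dot A C C - Rsqr (dot A B C).
Proof.
  unfold nondegenerate, collinear; intro H.
  apply Rlt_0_sqr in H.
  replace (_ - _) with (Rsqr (cross A B A C)) by (unfold Rsqr, cross, dot; ring).
  exact H.
Qed.

(** The terms quadratic in [t] cancel in [|BP|^2 - |CP|^2], so the condition is linear in [t]. *)
Lemma edist_eq_param (A B C P : point) (t : R) :
  fst P = fst A + t * (fst C - fst A) ->
  snd P = snd A + t * (snd C - snd A) ->
  edist B P = edist C P <->
  dot A B B - dot A C C = 2 * t * (dot A B C - dot A C C).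
Proof.
  intros Px Py; rewrite edist_eq_iff; unfold dot; rewrite Px, Py.
  split; intro H; lra.
Qed.

Lemma circumcenter_on_cevian_circle (A B C O P O' : point) :
  nondegenerate A B C -> is_circumcenter A B C O ->
  collinear A C P -> P <> A -> is_circumcenter A B P O' ->
  edist O' O = edist O' A <-> edist B P = edist C P.
Proof.
  intros ND [OB OC] HP PA [OB' OP'].
  destruct (nondegenerate_neq _ _ _ ND) as [HB HC].
  pose proof (dot_pos _ _ HB) as HBp.
  pose proof (dot_pos _ _ HC) as HCp.
  pose proof (gram_pos _ _ _ ND) as HG.
  destruct (collinear_param A C P HC HP) as [t [Px Py]].
  rewrite (edist_eq_param A B C P t Px Py), equidistant_iff_dot.
  symmetry in OB, OC, OB', OP'.
  apply equidistant_iff_dot in OB, OC, OB', OP'.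
  assert (Ht : t <> 0).
  { intros ->; apply PA, point_ext; rewrite ?Px, ?Py; ring. }
  assert (OP : 2 * dot A O' C = t * dot A C C).
  { apply Rmult_eq_reg_l with (2 := Ht).
    unfold dot in OP' |- *; rewrite Px, Py in OP'; lra. }
  (* Cramer's rule for O in the basis AB, AC. *)
  assert (Cramer : forall X,
    2 * (dot A B B * dot A C C - Rsqr (dot A B C)) * dot A O X =
    dot A C C * (dot A B B - dot A B C) * dot A B X
    + dot A B B * (dot A C C - dot A B C) * dot A C X).
  { intro X.
    transitivity
      ((2 * dot A O B * dot A C C - 2 * dot A O C * dot A B C) * dot A B X
       + (2 * dot A O C * dot A B B - 2 * dot A O B * dot A B C) * dot A C X).
    - unfold Rsqr, dot; ring.
    - rewrite <- OB, <- OC; ring. }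
  (* [dot A O O - 2 * dot A O' O] is the power of [O] with respect to the circle centred at [O']
     through [A]. Up to nonzero factors it equals the defect in [edist_eq_param], so the two vanish
     together. [Cramer] is used at [O] and at [O']. *)
  assert (K : 4 * (dot A B B * dot A C C - Rsqr (dot A B C))
                * (dot A O O - 2 * dot A O' O) =
              dot A B B * dot A C C *
                (2 * t * (dot A B C - dot A C C) - (dot A B B - dot A C C))).
  { pose proof (Cramer O) as K1; pose proof (Cramer O') as K2.
    replace (dot A B O) with (dot A O B) in K1 by (unfold dot; ring).
    replace (dot A C O) with (dot A O C) in K1 by (unfold dot; ring).
    replace (dot A B O') with (dot A O' B) in K2 by (unfold dot; ring).
    replace (dot A C O') with (dot A O' C) in K2 by (unfold dot; ring).
    replace (dot A O' O) with (dot A O O') by (unfold dot; ring).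
    replace (dot A O B) with (dot A B B / 2) in K1 by lra.
    replace (dot A O C) with (dot A C C / 2) in K1 by lra.
    replace (dot A O' B) with (dot A B B / 2) in K2 by lra.
    replace (dot A O' C) with (t * dot A C C / 2) in K2 by lra.
    lra. }
  split; intro H.
  - replace (dot A O O - 2 * dot A O' O) with 0 in K by lra.
    rewrite Rmult_0_r in K; symmetry in K.
    apply Rmult_integral in K as [K|K]; nra.
  - rewrite H in K.
    replace (2 * t * (dot A B C - dot A C C) - _) with 0 in K by ring.
    rewrite Rmult_0_r in K.
    apply Rmult_integral in K as [K|K]; lra.
Qed.

(** In the basis [AB], [AC] the two length conditions force [s + t = 2 * s * t] on the parameters of
    [CA] and [BA], and the circle equation at [N] follows from this and the two incidences. *)
Lemma cevian_intersection_on_circumcircle (A B C O BA CA N : point) :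
  nondegenerate A B C -> is_circumcenter A B C O ->
  collinear A C BA -> BA <> A -> collinear A B CA -> CA <> A ->
  is_cevian_intersection B C BA CA N ->
  edist B BA = edist C BA -> edist C CA = edist B CA ->
  edist O N = edist O A.
Proof.
  intros ND [OB OC] HBA BAA HCA CAA [NB NC] E1 E2.
  destruct (nondegenerate_neq _ _ _ ND) as [HB HC].
  pose proof (gram_pos _ _ _ ND) as HG.
  destruct (collinear_param A C BA HC HBA) as [t [Bx By]].
  destruct (collinear_param A B CA HB HCA) as [s [Cx Cy]].
  rewrite (edist_eq_param A B C BA t Bx By) in E1.
  rewrite (edist_eq_param A C B CA s Cx Cy) in E2.
  replace (dot A C B) with (dot A B C) in E2 by (unfold dot; ring).
  symmetry in OB, OC.
  apply equidistant_iff_dot in OB, OC.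
  apply equidistant_iff_dot.
  assert (Ht : t <> 0).
  { intros ->; apply BAA, point_ext; rewrite ?Bx, ?By; ring. }
  assert (Hs : s <> 0).
  { intros ->; apply CAA, point_ext; rewrite ?Cx, ?Cy; ring. }
  unfold nondegenerate, collinear in ND.
  set (D := cross A B A C) in ND.
  (* Cramer's rule: [x] and [y] are the coordinates of [N] with origin [A] and basis [AB], [AC]. *)
  set (x := cross A N A C / D).
  set (y := cross A B A N / D).
  assert (Nx : fst N = fst A + x * (fst B - fst A) + y * (fst C - fst A)).
  { unfold x, y; apply Rmult_eq_reg_l with (2 := ND).
    field_simplify; [|exact ND]; unfold D, cross; ring. }
  assert (Ny : snd N = snd A + x * (snd B - snd A) + y * (snd C - snd A)).
  { unfold x, y; apply Rmult_eq_reg_l with (2 := ND).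
    field_simplify; [|exact ND]; unfold D, cross; ring. }
  clearbody x y.
  assert (Y : y = t * (1 - x)).
  { apply Rmult_eq_reg_l with (2 := ND).
    unfold collinear, cross in NB; rewrite Bx, By, Nx, Ny in NB.
    unfold D, cross; lra. }
  assert (X : x = s * (1 - y)).
  { apply Rmult_eq_reg_l with (2 := ND).
    unfold collinear, cross in NC; rewrite Cx, Cy, Nx, Ny in NC.
    unfold D, cross; lra. }
  assert (NN : dot A N N = x * x * dot A B B + 2 * x * y * dot A B C
                           + y * y * dot A C C)
    by (unfold dot; rewrite Nx, Ny; ring).
  assert (ON : 2 * dot A O N = x * (2 * dot A O B) + y * (2 * dot A O C))
    by (unfold dot; rewrite Nx, Ny; ring).
  rewrite NN, ON, <- OB, <- OC.
  clear - HG E1 E2 Ht Hs X Y.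
  set (b := dot A C C) in *; set (c := dot A B B) in *; set (d := dot A B C) in *.
  clearbody b c d.
  assert (He : d - b <> 0).
  (* If [d = b], then [E1] gives [c = b], and the Gram determinant [c * b - d^2] would be zero. *)
  { intro He; unfold Rsqr in HG.
    assert (d = b) by lra; subst d.
    assert (c = b) by lra; subst c; lra. }
  assert (Hst : s + t = 2 * s * t).
  { apply Rmult_eq_reg_l with (2 := He).
    replace (d - c) with ((d - b) * (1 - 2 * t)) in E2 by lra; lra. }
  (* After [2 * s * t] becomes [s + t], this is half the sum of [E1] and [E2]. *)
  assert (K : 2 * s * t * d - s * c - t * b = 0) by (rewrite <- Hst; lra).
  apply Rminus_diag_uniq.
  apply Rmult_eq_reg_l with (r := s * t); [|now apply Rmult_integral_contrapositive].
  transitivity (x * y * (2 * s * t * d - s * c - t * b)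
    - s * x * c * (t * (1 - x) - y) - t * y * b * (s * (1 - y) - x)); [ring|].
  rewrite K, <- X, <- Y; ring.
Qed.

Theorem mainTheorem7 :
  forall A B C O : point,
    nondegenerate A B C ->
    is_circumcenter A B C O ->
    forall BA CA N M : point,
      admissible_cevians A B C BA CA ->
      is_cevian_intersection B C BA CA N ->
      is_miquel_steiner A B C BA CA N M ->
      (M = O <-> (edist B BA = edist C BA /\ edist C CA = edist B CA)) /\
      (M = O -> on_circumcircle A B C N).
Proof.
  intros A B C O ND HO BA CA N M
    [[HBA [BAA BAC]] [[HCA [CAA CAB]] _]] HN
    [[O1 [HO1 M1]] [[O2 [HO2 M2]] [[O3 [[O3BA O3N] M3]] _]]].
  destruct (nondegenerate_neq _ _ _ ND) as [HB HC].
  assert (HO' : is_circumcenter A C B O) by (destruct HO; now split).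
  pose proof (circumcenter_on_cevian_circle A B C O BA O1 ND HO HBA BAA HO1) as I1.
  pose proof (circumcenter_on_cevian_circle A C B O CA O2
                (nondegenerate_swap _ _ _ ND) HO' HCA CAA HO2) as I2.
  assert (HMO : M = O <-> (edist B BA = edist C BA /\ edist C CA = edist B CA)).
  { split.
    - intros ->; split; [now apply I1 | now apply I2].
    - intros [E1 E2].
      apply (second_intersection_unique A O1 O2).
      (* A common center would give a circle through the three collinear points [A], [C], [BA]. *)
      + intros ->.
        destruct HO1 as [_ P1], HO2 as [P2 _].
        now apply (collinear_not_equidistant A C BA O2).
      (* If [M = A], the circle of [C], [BA], [N] would pass through [A], again giving three
         collinear points on a circle. *)
      + intros ->.
        apply (collinear_not_equidistant A C BA O3); congruence.
      + intros ->; destruct HO as [OB _].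
        pose proof (dot_pos _ _ HB) as HBp.
        apply edist_eq_iff in OB; unfold dot in OB, HBp; lra.
      + exact M1.
      + exact M2.
      + now apply I1.
      + now apply I2. }
  split; [exact HMO|].
  intro E; apply HMO in E as [E1 E2].
  exists O; split; [exact HO|].
  now apply (cevian_intersection_on_circumcircle A B C O BA CA N).
Qed.
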